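(* For any fixed $0 < \theta < 1/2$, the asymptotic formula $$Q\bigl(x + x^{1/2+\theta}\bigr) - Q(x) \sim \frac{\zeta(3/2)}{2\zeta(3)}\, x^{\theta}$$ is true for almost all $x \in [X, 2X]$.
   Context: A positive integer $n$ is squarefull if $p^2 \mid n$ for every prime $p \mid n$ (so $1$ is squarefull). $Q(x)$ denotes the number of squarefull positive integers $n \le x$. $\zeta$ is the Riemann zeta function. ''For almost all $x \in [X,2X]$'' means for all $x \in [X,2X]$ apart from a set of Lebesgue measure $o(X)$ as $X \to \infty$. Thus the assertion is that for every $\eta > 0$, the set of $x \in [X,2X]$ with $\bigl| Q(x+x^{1/2+\theta}) - Q(x) - \frac{\zeta(3/2)}{2\zeta(3)} x^\theta \bigr| > \eta x^\theta$ has measure $o(X)$ as $X \to \infty$. *)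

(* Defs.v *)
From HB Require Import structures.
From mathcomp Require Import all_boot all_order all_algebra.
From mathcomp Require Import all_classical all_reals all_analysis.
Import Order.TTheory GRing.Theory Num.Theory.
Import numFieldNormedType.Exports.

Set Implicit Arguments.
Unset Strict Implicit.
Unset Printing Implicit Defensive.

Local Open Scope ring_scope.

Definition squarefull (n : nat) : bool :=
  ((0 < n) && all (fun p => p ^ 2 %| n) (primes n))%N.

Lemma squarefullP (n : nat) :
  reflect ((0 < n)%N /\ forall p, prime p -> (p %| n)%N -> (p ^ 2 %| n)%N)
          (squarefull n).
Proof.
apply: (iffP andP) => -[n_gt0 H]; split => //.
  by move=> p pp pn; apply: (allP H); rewrite mem_primes pp n_gt0.
by apply/allP => p; rewrite mem_primes => /and3P[pp _ pn]; apply: H.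
Qed.

Definition squarefull_count (R : realType) (x : R) : nat :=
  (\sum_(1 <= n < (Num.truncn x).+1 | squarefull n) 1)%N.

(* Truncating x loses nothing, also when x is negative. *)
Lemma squarefull_range (R : realType) (x : R) (n : nat) : (0 < n)%N ->
  (n < (Num.truncn x).+1)%N = (n%:R <= x).
Proof. by case: n => // n _; rewrite ltnS truncn_gt_nat. Qed.

(* The Dirichlet series of zeta at a real argument; the value is meaningful
   only for s > 1, where the series converges. *)
Definition zeta (R : realType) (s : R) : R := limn (series (riemannR s)).

(* Main.v *)
Require Import Defs.
From HB Require Import structures.
From mathcomp Require Import all_boot all_order all_algebra.
From mathcomp Require Import all_classical all_reals all_analysis.
From mathcomp Require Import measurable_realfun zify ring lra.
Import Order.TTheory GRing.Theory Num.Theory.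
Import numFieldNormedType.Exports.

Local Open Scope classical_set_scope.
Local Open Scope ring_scope.

(** Every squarefull [n] is [a ^ 2 * b ^ 3] for exactly one pair [(a, b)] with
[b] squarefree.  Put [y' = x + x ^ (1 / 2 + theta)].  For a fixed [b], the
number of [a] with [x < a ^ 2 * b ^ 3 <= y'] differs by at most 1 from
[(sqrt y' - sqrt x) * b ^ (- 3 / 2)], and [sqrt y' - sqrt x] is asymptotic to
[x ^ theta / 2].  Cut the sum over [b] at a constant [B].

The [b <= B] contribute [x ^ theta / 2] times the partial sum up to [B] of
[b ^ (- 3 / 2)] over squarefree [b], with an error [O(B) + o(x ^ theta)]
([sum_count_square_diff], [sqrt_increment]).  The full sum is
[zeta (3 / 2) / zeta 3], because [n = d ^ 2 * b] factors [zeta (3 / 2)]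
([limn_sqf32_sum]); so for [B] large this is the announced main term up to
[eta / 2 * x ^ theta].

The [b > B] need not contribute little at every [x], but they do on average.
Each [n = a ^ 2 * b ^ 3] is counted only for [x] in an interval of length
[L = (2 * X) ^ (1 / 2 + theta)] ending at [n], and there are at most
[sqrt (4 * X)] times the tail beyond [B] of the series of [n ^ (- 3 / 2)] such
[n] below [4 * X].  By Markov's inequality the count exceeds
[eta / 4 * X ^ theta] on a set of measure at most a constant times this tail
times [X / eta] ([large_cube_measure]).  Since the tail tends to 0 as [B] grows,
the exceptional set has measure [o(X)] ([deviation_subset] puts it inside the
set just bounded). *)

(** * Factorizations with a squarefree part *)

Definition squarefree (n : nat) : bool :=
  ((0 < n) && all (fun p => logn p n <= 1) (primes n))%N.

Lemma squarefree_logn n p : squarefree n -> (logn p n <= 1)%N.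
Proof.
move=> /andP[_ /allP h]; have [/h//|] := boolP (p \in primes n).
by rewrite -logn_gt0 lt0n negbK => /eqP ->.
Qed.

Lemma squarefree_gt0 n : squarefree n -> (0 < n)%N.
Proof. by case/andP. Qed.

(** If [p ^ 2] divides [n], decompose [n / p ^ 2] and multiply [d] by [p]. *)
Lemma exists_square_mul_squarefree n : (0 < n)%N ->
  exists d b, [/\ (0 < d)%N, squarefree b & (d ^ 2 * b = n)%N].
Proof.
elim/ltn_ind: n => n IH n0.
have [sf|] := boolP (squarefree n); first by exists 1%N, n; rewrite mul1n.
rewrite /squarefree n0 /= => /allPn[p].
rewrite mem_primes -ltnNge => /and3P[pp _ _].
rewrite -pfactor_dvdn// => /dvdnP[m nE].
have m0 : (0 < m)%N by move: n0; rewrite nE; case: (m).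
have p1 := prime_gt1 pp.
have mn : (m < n)%N by rewrite nE ltn_Pmulr// (ltn_exp2l 0).
have [d [b [d0 sb mE]]] := IH m mn m0.
exists (d * p)%N, b; split=> //.
  by rewrite muln_gt0 d0 prime_gt0.
by rewrite nE -mE expnMn mulnAC.
Qed.

(** The exponent of [p] in [n] determines that in [d], its half, and that in [b],
its parity. *)
Lemma square_mul_squarefree_inj d b d' b' :
  (0 < d)%N -> (0 < d')%N -> squarefree b -> squarefree b' ->
  (d ^ 2 * b = d' ^ 2 * b')%N -> d = d' /\ b = b'.
Proof.
move=> d0 d'0 sb sb' e.
have b0 := squarefree_gt0 _ sb; have b'0 := squarefree_gt0 _ sb'.
have log_eq p : (2 * logn p d + logn p b = 2 * logn p d' + logn p b')%N.
  by rewrite -!lognX -!lognM ?expn_gt0 ?d0 ?d'0// e.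
by split; apply: eqn_from_log => // p; move: (log_eq p)
  (squarefree_logn _ p sb) (squarefree_logn _ p sb'); lia.
Qed.

Lemma squarefull_square_mul_cube a b : (0 < a)%N -> squarefree b ->
  squarefull (a ^ 2 * b ^ 3).
Proof.
move=> a0 /squarefree_gt0 b0; apply/squarefullP; split.
  by rewrite muln_gt0 !expn_gt0 a0 b0.
move=> p pp; rewrite Euclid_dvdM// !Euclid_dvdX//= => /orP[] /andP[h _].
  exact/dvdn_mulr/dvdn_exp2r.
by apply: dvdn_mull; rewrite (expnSr b 2); exact/dvdn_mulr/dvdn_exp2r.
Qed.

(** In [n = d ^ 2 * b] with [b] squarefree, the primes of [b] are those of odd
exponent in [n].  If [n] is squarefull these exponents are at least 3, so the
same primes divide [d] and [b] can be moved from [d] to the other factor. *)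
Lemma squarefull_exists n : squarefull n ->
  exists a b, [/\ (0 < a)%N, squarefree b & (a ^ 2 * b ^ 3 = n)%N].
Proof.
move=> /squarefullP[n0 h].
have [d [b [d0 sb e]]] := exists_square_mul_squarefree _ n0.
have b0 := squarefree_gt0 _ sb.
have /dvdnP[a dE] : (b %| d)%N.
  apply/dvdn_partP => // p; rewrite mem_primes => /and3P[pp _ pb].
  rewrite p_part pfactor_dvdn//; apply: leq_trans (squarefree_logn _ p sb) _.
  have : (p ^ 2 %| n)%N by apply: h => //; rewrite -e dvdn_mull.
  rewrite pfactor_dvdn// -e lognM ?expn_gt0 ?d0// lognX.
  by move: (squarefree_logn _ p sb); lia.
exists a, b; split=> //; first by move: d0; rewrite dE; case: (a).
by rewrite -e dE; ring.
Qed.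

(** Apply [square_mul_squarefree_inj] to [(a * b) ^ 2 * b]. *)
Lemma square_mul_cube_inj a b a' b' :
  (0 < a)%N -> (0 < a')%N -> squarefree b -> squarefree b' ->
  (a ^ 2 * b ^ 3 = a' ^ 2 * b' ^ 3)%N -> a = a' /\ b = b'.
Proof.
move=> a0 a'0 sb sb' e.
have b0 := squarefree_gt0 _ sb; have b'0 := squarefree_gt0 _ sb'.
have [|||eab eb] := @square_mul_squarefree_inj (a * b) b (a' * b') b' _ _ sb sb'.
- by rewrite muln_gt0 a0.
- by rewrite muln_gt0 a'0.
- by transitivity (a ^ 2 * b ^ 3)%N; [ring | rewrite e; ring].
- by split=> //; apply/eqP; rewrite -(eqn_pmul2r b0) eab eb.
Qed.

Lemma sum_unique_pair (N a0 b0 : nat) (P : pred nat) (Q : rel nat) :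
  (0 < a0 <= N)%N -> (0 < b0 <= N)%N -> P b0 -> Q a0 b0 ->
  (forall a b, (0 < a)%N -> P b -> Q a b -> a = a0 /\ b = b0) ->
  (\sum_(1 <= b < N.+1 | P b) \sum_(1 <= a < N.+1) Q a b = 1)%N.
Proof.
move=> a0N b0N Pb0 Qab uniqQ.
rewrite big_mkcond (bigD1_seq b0) ?iota_uniq ?mem_index_iota//= Pb0.
rewrite (bigD1_seq a0) ?iota_uniq ?mem_index_iota//= Qab.
rewrite big_seq_cond big1 => [|a /andP[]]; last first.
  rewrite mem_index_iota => /andP[ap _] /eqP aa0.
  by case q: (Q a b0) => //; case: aa0; have [] := uniqQ _ _ ap Pb0 q.
rewrite addn0 big1// => b /eqP bb0; case: ifP => // Pb.
rewrite big_seq_cond big1// => a /andP[]; rewrite mem_index_iota => /andP[ap _] _.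
by case q: (Q a b) => //; case: bb0; have [] := uniqQ _ _ ap Pb q.
Qed.

Lemma count_square_mul_squarefree N n : (0 < n <= N)%N ->
  (\sum_(1 <= b < N.+1 | squarefree b)
     \sum_(1 <= d < N.+1) (d ^ 2 * b == n)%N = 1)%N.
Proof.
move=> /andP[n0 nN]; have [d [b [d0 sb e]]] := exists_square_mul_squarefree _ n0.
have b0 := squarefree_gt0 _ sb.
apply: (@sum_unique_pair _ d b) => //; rewrite ?d0 ?b0/= ?e//.
- by apply: leq_trans nN; rewrite -e; nia.
- by apply: leq_trans nN; rewrite -e; nia.
move=> a c a0 sc /eqP; rewrite -e.
exact: square_mul_squarefree_inj.
Qed.

Lemma count_square_mul_cube N n : (0 < n <= N)%N ->
  (\sum_(1 <= b < N.+1 | squarefree b)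
     \sum_(1 <= a < N.+1) (a ^ 2 * b ^ 3 == n)%N = squarefull n)%N.
Proof.
move=> /andP[n0 nN]; have [sn|nsn] := boolP (squarefull n); last first.
  rewrite big1// => b sb; rewrite big_seq_cond big1// => a /andP[].
  rewrite mem_index_iota => /andP[a0 _] _; case: eqP => // e.
  by rewrite -e squarefull_square_mul_cube in nsn.
have [a [b [a0 sb e]]] := squarefull_exists _ sn.
have b0 := squarefree_gt0 _ sb.
apply: (@sum_unique_pair _ a b) => //; rewrite ?a0 ?b0/= ?e//.
- apply: leq_trans nN; rewrite -e -[leqLHS]muln1.
  by rewrite leq_mul ?expn_gt0 ?b0 ?leq_pexp2l//; nia.
- by apply: leq_trans nN; rewrite -e -[leqLHS]mul1n leq_mul ?expn_gt0 ?a0//; nia.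
move=> a' b' a'0 sb' /eqP; rewrite -e.
exact: square_mul_cube_inj.
Qed.

Lemma sum_eq_nat t m : (0 < m)%N -> (\sum_(1 <= n < t.+1) (m == n) = (m <= t))%N.
Proof.
move=> m0; have [mt|tm] := leqP m t.
  rewrite (bigD1_seq m) ?iota_uniq ?mem_index_iota ?m0//= eqxx big1// => i.
  by rewrite eq_sym => /negbTE ->.
rewrite big_nat_cond big1// => i /andP[/andP[_ it] _].
by case: eqP => // e; rewrite -e ltnS leqNgt tm in it.
Qed.

(** The range [N] is independent of [y], so that the same sums serve for the two
ends of a short interval. *)
Lemma squarefull_countE (R : realType) (N : nat) (y : R) : (Num.truncn y <= N)%N ->
  squarefull_count y =
  (\sum_(1 <= b < N.+1 | squarefree b) \sum_(1 <= a < N.+1)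
     ((a ^ 2 * b ^ 3)%N%:R <= y)%R)%N.
Proof.
move=> yN; rewrite /squarefull_count big_mkcond/=.
transitivity (\sum_(1 <= n < (Num.truncn y).+1)
  \sum_(1 <= b < N.+1 | squarefree b) \sum_(1 <= a < N.+1) (a ^ 2 * b ^ 3 == n))%N.
  rewrite !big_nat; apply: eq_bigr => n /andP[n0 nt].
  rewrite count_square_mul_cube; first by case: squarefull.
  by rewrite n0 (leq_trans _ yN).
rewrite exchange_big/=; apply: eq_bigr => b /squarefree_gt0 b0.
rewrite exchange_big/= !big_nat; apply: eq_bigr => a /andP[a0 _].
have m0 : (0 < a ^ 2 * b ^ 3)%N by rewrite muln_gt0 !expn_gt0 a0 b0.
by rewrite sum_eq_nat// -squarefull_range.
Qed.

(** * The density of the squarefull numbers *)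

(** The weight [b ^ (- 3 / 2)], written with a square root because [inv32 b] enters
through the equivalence of [a ^ 2 * b ^ 3 <= y] and [a <= sqrt y * inv32 b]. *)
Definition inv32 (R : realType) (b : nat) : R := (Num.sqrt (b%:R ^+ 3))^-1.

Definition inv32_sum (R : realType) (N : nat) : R := \sum_(1 <= n < N.+1) inv32 R n.

Definition inv3_sum (R : realType) (N : nat) : R :=
  \sum_(1 <= n < N.+1) (n%:R ^+ 3)^-1.

Definition sqf32_sum (R : realType) (N : nat) : R :=
  \sum_(1 <= b < N.+1 | squarefree b) inv32 R b.

Lemma inv32_ge0 (R : realType) b : 0 <= inv32 R b.
Proof. by rewrite invr_ge0 sqrtr_ge0. Qed.

Lemma inv32_sqrt (R : realType) b : inv32 R b = (Num.sqrt b%:R ^+ 3)^-1.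
Proof.
congr (_ ^-1); apply/eqP; rewrite -(@eqrXn2 _ 2)// ?exprn_ge0 ?sqrtr_ge0//.
by rewrite sqr_sqrtr ?exprn_ge0// -exprM mulnC exprM sqr_sqrtr.
Qed.

Lemma inv32_square_mul (R : realType) d b :
  inv32 R (d ^ 2 * b) = (d%:R ^+ 3)^-1 * inv32 R b.
Proof.
rewrite !inv32_sqrt natrM natrX sqrtrM ?exprn_ge0// sqrtr_sqr ger0_norm//.
by rewrite exprMn invfM.
Qed.

Lemma powR32 (R : realType) (x : R) : 0 <= x -> x `^ (3 / 2) = Num.sqrt (x ^+ 3).
Proof.
move=> x0; transitivity ((x `^ 3) `^ 2^-1); first exact: powRrM.
by rewrite (powR_mulrn 3 x0) powR12_sqrt// exprn_ge0.
Qed.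

Lemma series_riemannR32 (R : realType) :
  series (riemannR (3 / 2 : R)) = inv32_sum R.
Proof.
apply/funext => N; rewrite /series/= /inv32_sum big_add1/=.
apply: eq_bigr => n _; rewrite /inv32; congr (_ ^-1).
exact: powR32.
Qed.

Lemma series_riemannR3 (R : realType) : series (riemannR (3 : R)) = inv3_sum R.
Proof.
apply/funext => N; rewrite /series/= /inv3_sum big_add1/=.
by apply: eq_bigr => n _; congr (_ ^-1); exact: (powR_mulrn 3).
Qed.

(** Telescoping, from [inv32 n <= 2 / sqrt (n - 1) - 2 / sqrt n] for [n > 1]. *)
Lemma inv32_sum_le3 (R : realType) N : inv32_sum R N <= 3.
Proof.
have h M : inv32_sum R M.+1 <= 3 - 2 / Num.sqrt M.+1%:R.
  elim: M => [|M IH].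
    by rewrite /inv32_sum big_nat1 inv32_sqrt sqrtr1 expr1n invr1; lra.
  rewrite /inv32_sum big_nat_recr//= -/(inv32_sum R M.+1) inv32_sqrt.
  apply: le_trans (lerD IH (lexx _)) _.
  have : Num.sqrt M.+2%:R ^+ 2 = Num.sqrt M.+1%:R ^+ 2 + 1 :> R.
    by rewrite !sqr_sqrtr// -natr1.
  have : 0 < Num.sqrt M.+1%:R :> R by rewrite sqrtr_gt0.
  have : 0 < Num.sqrt M.+2%:R :> R by rewrite sqrtr_gt0.
  set s := Num.sqrt M.+1%:R; set t := Num.sqrt M.+2%:R => t0 s0 ts.
  have st : s <= t by nra.
  rewrite -subr_ge0.
  have -> : 3 - 2 / t - (3 - 2 / s + (t ^+ 3)^-1) =
    (2 * t ^+ 2 * (t - s) - s) / (s * t ^+ 3).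
    by field; rewrite !gt_eqF.
  apply: divr_ge0; last by rewrite mulr_ge0 ?exprn_ge0 ?ltW.
  rewrite subr_ge0.
  have e : (t - s) * (t + s) = 1 by rewrite -subr_sqr ts addrAC subrr add0r.
  have e2 : (t - s) * (t * (t + s)) = t by rewrite mulrCA e mulr1.
  have : 0 <= (t - s) ^+ 2 * t by rewrite mulr_ge0 ?sqr_ge0 ?ltW.
  nra.
case: N => [|N]; first by rewrite /inv32_sum big_geq.
by apply: le_trans (h N) _; rewrite lerBlDr lerDl divr_ge0 ?sqrtr_ge0.
Qed.

Lemma nondecreasing_sum_nat (R : realType) (P : pred nat) (f : nat -> R) :
  (forall n, 0 <= f n) ->
  nondecreasing_seq (fun N => \sum_(1 <= n < N.+1 | P n) f n).
Proof.
move=> f0; apply/nondecreasing_seqP => N.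
by rewrite big_mkcond [leRHS]big_mkcond [leRHS]big_nat_recr//= lerDl; case: ifP.
Qed.

Lemma is_cvg_sum_nat (R : realType) (P : pred nat) (f : nat -> R) (M : R) :
  (forall n, 0 <= f n) -> (forall N, \sum_(1 <= n < N.+1 | P n) f n <= M) ->
  cvgn (fun N => \sum_(1 <= n < N.+1 | P n) f n).
Proof.
move=> f0 fM; apply: nondecreasing_is_cvgn; first exact: nondecreasing_sum_nat.
by exists M => _ [N _ <-]; exact: fM.
Qed.

Lemma sqf32_sum_le_inv32_sum (R : realType) N : sqf32_sum R N <= inv32_sum R N.
Proof.
rewrite /sqf32_sum /inv32_sum big_mkcond ler_sum// => n _.
by case: ifP => //; rewrite inv32_ge0.
Qed.

Lemma inv3_le_inv32 (R : realType) n : (n%:R ^+ 3)^-1 <= inv32 R n.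
Proof.
case: n => [|n]; first by rewrite expr0n/= invr0 inv32_ge0.
rewrite /inv32 lef_pV2 ?posrE ?sqrtr_gt0 ?exprn_gt0//.
have : 1 <= n.+1%:R ^+ 3 :> R by rewrite exprn_ege1// ler1n.
set u := _ ^+ 3 => u1; rewrite -[leRHS]ger0_norm; last lra.
by rewrite -sqrtr_sqr ler_wsqrtr//; nra.
Qed.

Lemma inv3_sum_le_inv32_sum (R : realType) N : inv3_sum R N <= inv32_sum R N.
Proof. by apply: ler_sum => n _; exact: inv3_le_inv32. Qed.

Lemma is_cvg_inv32_sum (R : realType) : cvgn (inv32_sum R).
Proof.
apply: (@is_cvg_sum_nat _ xpredT _ 3); first exact: inv32_ge0.
exact: inv32_sum_le3.
Qed.

Lemma is_cvg_inv3_sum (R : realType) : cvgn (inv3_sum R).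
Proof.
apply: (@is_cvg_sum_nat _ xpredT _ 3) => [n|N]; first by rewrite invr_ge0 exprn_ge0.
exact: le_trans (inv3_sum_le_inv32_sum _ _) (inv32_sum_le3 _ _).
Qed.

Lemma is_cvg_sqf32_sum (R : realType) : cvgn (sqf32_sum R).
Proof.
apply: (@is_cvg_sum_nat _ _ _ 3) => [n|N]; first exact: inv32_ge0.
exact: le_trans (sqf32_sum_le_inv32_sum _ _) (inv32_sum_le3 _ _).
Qed.

Lemma inv3_sumM_sqf32_sum (R : realType) N : inv3_sum R N * sqf32_sum R N =
  \sum_(1 <= b < N.+1 | squarefree b) \sum_(1 <= d < N.+1) inv32 R (d ^ 2 * b).
Proof.
rewrite mulrC /sqf32_sum mulr_suml; apply: eq_bigr => b _.
rewrite mulr_sumr; apply: eq_bigr => d _.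
by rewrite inv32_square_mul mulrC.
Qed.

Lemma sum_inv32_square_mul_le (R : realType) M N :
  \sum_(1 <= b < M.+1 | squarefree b) \sum_(1 <= d < M.+1)
     \sum_(1 <= n < N.+1) ((d ^ 2 * b)%N == n)%:R * inv32 R n
  <= inv3_sum R M * sqf32_sum R M.
Proof.
rewrite inv3_sumM_sqf32_sum; apply: ler_sum => b sb; apply: ler_sum => d _.
have [dN|Nd] := boolP ((d ^ 2 * b)%N \in index_iota 1 N.+1).
  rewrite (bigD1_seq (d ^ 2 * b)%N) ?iota_uniq//= eqxx mul1r big1 ?addr0// => n.
  by rewrite eq_sym => /negbTE ->; rewrite mul0r.
rewrite big_seq big1 ?inv32_ge0// => n nN.
by case: eqP => [e|_]; rewrite ?mul0r//; rewrite e nN in Nd.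
Qed.

(** If [n = d ^ 2 * b] is at most [N], then so are [d] and [b]. *)
Lemma inv32_sum_le_mul (R : realType) N :
  inv32_sum R N <= inv3_sum R N * sqf32_sum R N.
Proof.
apply: le_trans (sum_inv32_square_mul_le _ N N).
under eq_bigr do rewrite exchange_big/=.
rewrite exchange_big/= /inv32_sum ler_sum_nat// => n /andP[n0 nN].
under eq_bigr do rewrite -mulr_suml.
rewrite -mulr_suml -[leLHS]mul1r ler_wpM2r ?inv32_ge0//.
under eq_bigr do rewrite -natr_sum.
by rewrite -natr_sum count_square_mul_squarefree// n0.
Qed.

Lemma leq_sum_widen (P : pred nat) (F : nat -> nat) N M : (N <= M)%N ->
  (\sum_(1 <= i < N.+1 | P i) F i <= \sum_(1 <= i < M.+1 | P i) F i)%N.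
Proof. by move=> NM; rewrite [leqRHS](@big_cat_nat _ _ _ N.+1)//= leq_addr. Qed.

(** Pairs [(d, b)] up to [N] have [d ^ 2 * b <= N ^ 3], and they give distinct
products. *)
Lemma mul_le_inv32_sum (R : realType) N :
  inv3_sum R N * sqf32_sum R N <= inv32_sum R (N ^ 3).
Proof.
rewrite inv3_sumM_sqf32_sum.
have -> : \sum_(1 <= b < N.+1 | squarefree b)
     \sum_(1 <= d < N.+1) inv32 R (d ^ 2 * b)
  = \sum_(1 <= b < N.+1 | squarefree b) \sum_(1 <= d < N.+1)
     \sum_(1 <= n < (N ^ 3).+1) ((d ^ 2 * b)%N == n)%:R * inv32 R n.
  rewrite big_nat_cond [RHS]big_nat_cond; apply: eq_bigr => b /andP[/andP[b0 bN] _].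
  rewrite !big_nat; apply: eq_bigr => d /andP[d0 dN].
  rewrite (bigD1_seq (d ^ 2 * b)%N) ?iota_uniq//=; last first.
    rewrite mem_index_iota muln_gt0 expn_gt0 d0 b0/= ltnS (expnSr N 2).
    by rewrite leq_mul// leq_exp2r.
  rewrite eqxx mul1r big1 ?addr0// => n.
  by rewrite eq_sym => /negbTE ->; rewrite mul0r.
under eq_bigr do rewrite exchange_big/=.
rewrite exchange_big/= /inv32_sum ler_sum_nat// => n /andP[n0 nN].
under eq_bigr do rewrite -mulr_suml.
rewrite -mulr_suml -[leRHS]mul1r ler_wpM2r ?inv32_ge0//.
under eq_bigr do rewrite -natr_sum.
have nmax : (0 < n <= maxn N n)%N by rewrite n0 leq_maxr.
rewrite -natr_sum (ler_nat _ _ 1).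
apply: leq_trans (eq_leq (count_square_mul_squarefree _ _ nmax)).
apply: leq_trans (leq_sum_widen _ _ _ _ (leq_maxl N n)).
by apply: leq_sum => b _; exact/leq_sum_widen/leq_maxl.
Qed.


(** Summing [n ^ (- 3 / 2)] along [n = d ^ 2 * b] gives
[zeta (3 / 2) = zeta 3 * limn (sqf32_sum R)]. *)
Lemma limn_sqf32_sum (R : realType) :
  limn (sqf32_sum R) = zeta (3 / 2 : R) / zeta (3 : R).
Proof.
rewrite /zeta series_riemannR32 series_riemannR3.
have cw := @is_cvg_inv32_sum R.
have cc := @is_cvg_inv3_sum R; have cs := @is_cvg_sqf32_sum R.
have inv3_sum_gt0 : 0 < limn (inv3_sum R).
  apply: (@lt_le_trans _ _ (inv3_sum R 1)).
    by rewrite /inv3_sum big_nat1 expr1n invr1.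
  apply: nondecreasing_cvgn_le => //.
  by apply: (@nondecreasing_sum_nat _ xpredT) => n; rewrite invr_ge0 exprn_ge0.
apply: (mulIf (lt0r_neq0 inv3_sum_gt0)); rewrite divfK ?lt0r_neq0//.
rewrite mulrC -limM//.
have cm : cvgn (inv3_sum R \* sqf32_sum R) by exact: is_cvgM.
apply/eqP; rewrite eq_le; apply/andP; split.
  apply: limr_le => //; near=> N; apply: le_trans (mul_le_inv32_sum _ _) _.
  apply: nondecreasing_cvgn_le => //.
  by apply: (@nondecreasing_sum_nat _ xpredT); exact: inv32_ge0.
by apply: ler_lim => //; near=> N; exact: inv32_sum_le_mul.
Unshelve. all: by end_near. Qed.

Lemma inv32_sum_tail (R : realType) (e : R) : 0 < e ->
  \forall B \near \oo, forall N, inv32_sum R N - inv32_sum R B <= e.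
Proof.
move=> e0; have /cvgrPdist_le /(_ _ e0) := @is_cvg_inv32_sum R.
apply: filterS => B le_e N.
apply: le_trans (le_trans (ler_norm _) le_e); rewrite lerB//.
apply: nondecreasing_cvgn_le; last exact: is_cvg_inv32_sum.
by apply: (@nondecreasing_sum_nat _ xpredT); exact: inv32_ge0.
Qed.

(** * Counting squares times a fixed cube *)

(** The count is complete as soon as [truncn y <= N], see [count_square_ge]; the
upper bound [count_square_le] holds for every [N]. *)
Definition count_square (R : realType) (N b : nat) (y : R) : nat :=
  (\sum_(1 <= a < N.+1) ((a ^ 2 * b ^ 3)%N%:R <= y)%R)%N.

Lemma sum_leq_minn N t : (\sum_(1 <= a < N.+1) (a <= t) = minn N t)%N.
Proof.
elim: N => [|N IH]; first by rewrite big_geq// min0n.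
by rewrite big_nat_recr//= IH; lia.
Qed.

Lemma square_mul_cube_le (R : realType) (a b : nat) (y : R) : (0 < b)%N -> 0 <= y ->
  ((a ^ 2 * b ^ 3)%N%:R <= y) = (a%:R <= Num.sqrt y * inv32 R b).
Proof.
move=> b0 y0; have q0 : 0 < Num.sqrt (b%:R ^+ 3) :> R.
  by rewrite sqrtr_gt0 exprn_gt0// ltr0n.
rewrite /inv32 ler_pdivlMr// -ler_sqrt// natrM !natrX sqrtrM ?exprn_ge0//.
by rewrite sqrtr_sqr ger0_norm.
Qed.

Lemma count_squareE (R : realType) N b (y : R) : (0 < b)%N -> 0 <= y ->
  count_square R N b y = minn N (Num.truncn (Num.sqrt y * inv32 R b)).
Proof.
move=> b0 y0; rewrite -sum_leq_minn; apply: eq_bigr => a _.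
by rewrite square_mul_cube_le// truncn_ge_nat// mulr_ge0 ?sqrtr_ge0 ?inv32_ge0.
Qed.

Lemma count_square_le (R : realType) N b (y : R) : (0 < b)%N -> 0 <= y ->
  (count_square R N b y)%:R <= Num.sqrt y * inv32 R b.
Proof.
move=> b0 y0; rewrite count_squareE//.
have w0 : 0 <= Num.sqrt y * inv32 R b by rewrite mulr_ge0 ?sqrtr_ge0 ?inv32_ge0.
by apply: le_trans (_ : (Num.truncn (Num.sqrt y * inv32 R b))%:R <= _);
  rewrite ?ler_nat ?geq_minr ?truncn_le.
Qed.

Lemma count_square_ge (R : realType) N b (y : R) : (0 < b)%N -> 0 <= y ->
  (Num.truncn y <= N)%N -> Num.sqrt y * inv32 R b <= (count_square R N b y)%:R + 1.
Proof.
move=> b0 y0 yN; rewrite count_squareE//.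
have w0 : 0 <= Num.sqrt y * inv32 R b by rewrite mulr_ge0 ?sqrtr_ge0 ?inv32_ge0.
have /andP[tle /ltW tlt] := truncn_itv w0.
rewrite (minn_idPr _) ?natr1//; apply: leq_trans yN.
move: tle; rewrite -square_mul_cube_le//; set t := Num.truncn _ => tle.
rewrite truncn_ge_nat//; apply: le_trans tle; rewrite ler_nat.
by rewrite -[leqLHS]muln1 leq_mul ?expn_gt0 ?b0//; nia.
Qed.

Lemma count_square_diff (R : realType) N b (y y' : R) :
  (0 < b)%N -> 0 <= y -> y <= y' ->
  (Num.truncn y' <= N)%N ->
  `|(count_square R N b y')%:R - (count_square R N b y)%:R
    - (Num.sqrt y' - Num.sqrt y) * inv32 R b| <= 1.
Proof.
move=> b0 y0 yy' y'N; have y'0 := le_trans y0 yy'.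
have := count_square_le _ N _ _ b0 y0; have := count_square_le _ N _ _ b0 y'0.
have := count_square_ge _ _ _ _ b0 y'0 y'N.
have := count_square_ge _ _ _ _ b0 y0 (leq_trans (le_truncn yy') y'N).
rewrite ler_norml mulrBl; lra.
Qed.

Lemma sum_count_square_diff (R : realType) B N (y y' : R) : 0 <= y -> y <= y' ->
  (Num.truncn y' <= N)%N ->
  `|\sum_(1 <= b < B.+1 | squarefree b)
       ((count_square R N b y')%:R - (count_square R N b y)%:R)
    - (Num.sqrt y' - Num.sqrt y) * sqf32_sum R B| <= B%:R.
Proof.
move=> y0 yy' y'N; rewrite /sqf32_sum mulr_sumr -sumrB.
apply: le_trans (ler_norm_sum _ _ _) _.
apply: (@le_trans _ _ (\sum_(1 <= b < B.+1) 1)); last first.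
  by rewrite sumr_const_nat subn1.
rewrite [leRHS](bigID squarefree)/= -[leLHS]addr0 lerD ?sumr_ge0//.
by apply: ler_sum => b /squarefree_gt0 b0; exact: count_square_diff.
Qed.

(** * The contribution of the large cubes on average *)

Definition large_cube_points (R : realType) (B N : nat) (Y : R) : seq R :=
  [seq (a ^ 2 * b ^ 3)%N%:R
     | b <- [seq b <- index_iota B.+1 N.+1 | squarefree b],
       a <- [seq a <- index_iota 1 N.+1 | (a ^ 2 * b ^ 3)%N%:R <= Y]].

Lemma sum_large_cube_points (R : realType) B N (Y : R) (f : R -> R) :
  \sum_(r <- large_cube_points R B N Y) f r =
  \sum_(B.+1 <= b < N.+1 | squarefree b)
    \sum_(1 <= a < N.+1 | (a ^ 2 * b ^ 3)%N%:R <= Y) f (a ^ 2 * b ^ 3)%N%:R.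
Proof.
rewrite /large_cube_points big_allpairs_dep big_filter.
by apply: eq_bigr => b _; rewrite big_filter.
Qed.

Lemma size_large_cube_points (R : realType) B N (Y : R) : (B <= N)%N -> 0 <= Y ->
  (size (large_cube_points R B N Y))%:R
  <= Num.sqrt Y * (inv32_sum R N - inv32_sum R B).
Proof.
move=> BN Y0; rewrite -sum1_size natr_sum sum_large_cube_points.
rewrite /inv32_sum (@big_cat_nat _ _ _ B.+1 1 N.+1)//= addrAC subrr add0r mulr_sumr.
rewrite [leRHS](bigID squarefree)/= -[leLHS]addr0 lerD ?sumr_ge0//; last first.
  by move=> b _; rewrite mulr_ge0 ?sqrtr_ge0 ?inv32_ge0.
apply: ler_sum => b /squarefree_gt0 b0.
apply: le_trans (count_square_le _ N _ _ b0 Y0).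
rewrite big_mkcond/= /count_square natr_sum; apply: ler_sum => a _.
by case: ifP.
Qed.

(** An integer [n] with [y < n <= y'] has [n - L <= y < n]. On the right-hand side
the dependence on [y'] is gone: this makes the bound measurable and easy to
integrate over [y]. *)
Lemma sum_count_square_large_le (R : realType) B N (y y' Y L : R) :
  y' <= y + L -> y' <= Y ->
  \sum_(B.+1 <= b < N.+1 | squarefree b)
    ((count_square R N b y')%:R - (count_square R N b y)%:R)
  <= \sum_(r <- large_cube_points R B N Y) (\1_(`[r - L, r[%classic : set R) y : R).
Proof.
move=> y'L y'Y; rewrite sum_large_cube_points; apply: ler_sum => b _.
rewrite big_mkcond/= /count_square !natr_sum -sumrB; apply: ler_sum => a _.
set n := (_ * _)%N%:R; rewrite indicE.
have [ny'|y'n] := leP n y'; last first.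
  by apply: (@le_trans _ _ 0); [rewrite sub0r oppr_le0 | case: ifP].
rewrite (le_trans ny' y'Y); have [ny|yn] := leP n y; first by rewrite subrr.
rewrite subr0 mem_set//= in_itv/= yn andbT; lra.
Qed.

Lemma markov_nneg (d : measure_display) (T : measurableType d) (R : realType)
    (mu : {measure set T -> \bar R}) (f : T -> R) (c : R) : 0 < c ->
  measurable_fun setT f -> (forall x, 0 <= f x) ->
  (c%:E * mu [set x | (c <= f x)%R] <= \int[mu]_x (f x)%:E)%E.
Proof.
move=> c0 mf f0.
have mEf : measurable_fun [set: T] (fun x => (f x)%:E) by exact/measurable_EFinP.
have := @le_integral_comp_abse _ _ _ mu setT measurableT
  (EFin \o f) c idfun (@measurable_id _ _ _)
  (fun r h => h) (fun x y _ _ h => h) mEf c0.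
rewrite setTI (_ : [set x | (c%:E <= `|(EFin \o f) x|)%E] = [set x | (c <= f x)%R]).
  move=> h; apply: le_trans h _; rewrite le_eqVlt; apply/orP; left; apply/eqP.
  by apply: eq_integral => x _ /=; rewrite ger0_norm.
by apply/seteqP; split => x /=; rewrite ger0_norm.
Qed.

(** The integral of the sum of the indicators is [size s * L]. *)
Lemma markov_intervals (R : realType) (s : seq R) (L c : R) : 0 <= L -> 0 < c ->
  (lebesgue_measure
     [set x : R | (c <= \sum_(r <- s) (\1_(`[r - L, r[%classic : set R) x : R))%R]
   <= ((size s)%:R * L / c)%:E)%E.
Proof.
move=> L0 c0.
have mI (r : R) : measurable_fun [set: measurableTypeR R]
    (\1_(`[r - L, r[%classic : set R) : R -> R).
  exact: measurable_indic.
rewrite EFinM lee_pdivlMr// muleC.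
apply: le_trans (markov_nneg _ _ _ _ _ _ c0 _ _) _.
- exact: measurable_sum.
- by move=> x; apply: sumr_ge0.
under eq_integral do rewrite -sumEFin.
rewrite ge0_integral_sum//; last first.
  by move=> r; apply/measurable_EFinP.
rewrite le_eqVlt; apply/orP; left; apply/eqP.
transitivity (\sum_(r <- s) L%:E)%E.
  apply: eq_bigr => r _; rewrite integral_indic// setIT.
  transitivity (if r - L < r then (r%:E - (r - L)%:E)%E else 0%E).
    by rewrite -lte_fin; exact: lebesgue_measure_itv.
  case: ifPn => [_|].
    by rewrite -EFinB; congr (_%:E); ring.
  by rewrite ltrBlDr ltrDl -leNgt => h; congr (_%:E); apply/eqP; rewrite eq_le L0.
by rewrite sumEFin big_const_seq count_predT iter_addr_0 mulr_natl.
Qed.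

(** Monotonicity holds for arbitrary sets because the Lebesgue measure is defined
on all of them, as the outer measure that extends the length of intervals. *)
Lemma le_lebesgue_measure (R : realType) (A B : set R) : A `<=` B ->
  (lebesgue_measure A <= lebesgue_measure B)%E.
Proof. move=> AB; exact: (@le_mu_ext _ _ _ (wlength (@idfun R)) _ _ AB). Qed.

Lemma near_powR_ge (R : realType) (p M : R) : 0 < p ->
  \forall X \near +oo, M <= X `^ p.
Proof.
move=> p0; near=> X.
apply: (@le_trans _ _ ((`|M| `^ p^-1) `^ p)).
  by rewrite -powRrM mulVf ?gt_eqF// powRr1// ler_norm.
by apply: ge0_ler_powR; rewrite ?nnegrE ?powR_ge0// ?ltW.
Unshelve. all: by end_near. Qed.

(** * The exceptional set *)

(** Here [s = sqrt x] and [h = x ^ theta], so that [s * h] is the length of the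
short interval. With [t] the square root on the left,
[(t - s) * (t + s) = s * h] gives [h / 2 - (t - s) = h / 2 * (t - s) / (t + s)]. *)
Lemma sqrt_increment (R : realType) (s h : R) : 0 < s -> 0 <= h ->
  `|Num.sqrt (s ^+ 2 + s * h) - s - h / 2| <= h ^+ 2 / s.
Proof.
move=> s0 h0; set t := Num.sqrt _.
have t0 : 0 <= t by exact: sqrtr_ge0.
have sh0 : 0 <= s * h by rewrite mulr_ge0// ltW.
have t2 : t ^+ 2 = s ^+ 2 + s * h by rewrite sqr_sqrtr// addr_ge0// sqr_ge0.
have st : s <= t by rewrite -(@ler_pXn2r _ 2)// ?nnegrE ?(ltW s0)// t2 lerDl.
have tsh : t <= s + h / 2.
  rewrite -(@ler_pXn2r _ 2)// ?nnegrE; last by lra.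
  by rewrite t2; have := sqr_ge0 h; nra.
have e : (t - s) * (t + s) = s * h by rewrite -subr_sqr t2; ring.
rewrite ler_norml; apply/andP; split; last first.
  by apply: (@le_trans _ _ 0); [lra | rewrite divr_ge0 ?sqr_ge0 ?ltW].
rewrite lerNl ler_pdivlMr//.
have : (h / 2 - (t - s)) * (t + s) = h / 2 * (t - s) by rewrite mulrBl e; lra.
nra.
Qed.

Lemma squarefull_count_split (R : realType) (B N : nat) (y y' : R) :
  (B <= N)%N -> y <= y' -> (Num.truncn y' <= N)%N ->
  (squarefull_count y')%:R - (squarefull_count y)%:R =
  \sum_(1 <= b < B.+1 | squarefree b)
    ((count_square R N b y')%:R - (count_square R N b y)%:R)
  + \sum_(B.+1 <= b < N.+1 | squarefree b)
      ((count_square R N b y')%:R - (count_square R N b y)%:R) :> R.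
Proof.
move=> BN yy' y'N; rewrite -(@big_cat_nat _ _ _ B.+1 1 N.+1)//= sumrB.
rewrite (squarefull_countE _ N y') // (squarefull_countE _ N y); last first.
  exact: leq_trans (le_truncn yy') y'N.
by rewrite !natr_sum.
Qed.

(** With [h = x ^ p], the deviation is at most the contribution [T] of the [b > B]
plus [3 / 4 * eta * h]: a quarter from each of the [B] rounding errors together,
the approximation of [sqrt y' - sqrt x] by [h / 2], and the truncation
[S - sqf32_sum R B] of the density. A deviation above [eta * h]
therefore forces [T > eta / 4 * h]. *)
Lemma deviation_subset (R : realType) (p q S eta : R) (B N : nat) (X : R) :
  0 < eta -> 1 <= X -> 0 < p < 1 / 2 ->
  S - sqf32_sum R B <= eta / 2 -> sqf32_sum R B <= S ->
  4 * B%:R / eta <= X `^ p -> 12 / eta <= X `^ (1 / 2 - p) ->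
  (B <= N)%N -> (Num.truncn (4 * X) <= N)%N ->
  [set x : R | X <= x <= 2 * X /\
     `| (squarefull_count (x + x `^ (1 / 2 + p)))%:R - (squarefull_count x)%:R
         - S / 2 * x `^ p | > eta * x `^ p]
  `<=` [set x : R | eta / 4 * X `^ p <=
     \sum_(r <- large_cube_points R B N (4 * X))
       (\1_(`[r - (2 * X) `^ (1 / 2 + p), r[%classic : set R) x : R)].
Proof.
move=> eta0 X1 /andP[p0 p12] S1 S2 XB X12 BN XN x /= [/andP[Xx x2X]] dev.
have x1 : 1 <= x := le_trans X1 Xx.
have x0 : 0 < x by apply: lt_le_trans x1.
have X0 : 0 < X by apply: lt_le_trans X1.
set h := x `^ p in dev *; pose s := Num.sqrt x.
have s0 : 0 < s by rewrite sqrtr_gt0.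
have sE : x `^ (1 / 2) = s by rewrite mul1r powR12_sqrt// ltW.
have s2 : s ^+ 2 = x by rewrite sqr_sqrtr// ltW.
have H : x `^ (1 / 2 + p) = s * h.
  by rewrite powRD ?sE//; apply/implyP => _; rewrite gt_eqF.
have h0 : 0 < h by exact: powR_gt0.
have Xh : X `^ p <= h.
  by apply: ge0_ler_powR; rewrite ?nnegrE ?(ltW X0) ?(ltW x0) ?(ltW p0).
have hs : h * 12 <= eta * s.
  (* s = x ^ (1 / 2) is split as h * x ^ (1 / 2 - p) *)
  rewrite -sE (_ : 1 / 2 = p + (1 / 2 - p)); last by lra.
  rewrite powRD -/h; last by apply/implyP => _; rewrite gt_eqF.
  rewrite mulrCA ler_pM2l//; rewrite ler_pdivrMr// in X12.
  apply: le_trans X12 _; rewrite mulrC ler_pM2l//.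
  by apply: ge0_ler_powR; rewrite ?nnegrE ?(ltW X0) ?(ltW x0)//; lra.
have Hx : x `^ (1 / 2 + p) <= x by apply: ler1_powR => //; lra.
pose y' := x + x `^ (1 / 2 + p).
have xy' : x <= y' by rewrite lerDl powR_ge0.
have y'4 : y' <= 4 * X by rewrite /y'; lra.
have y'N : (Num.truncn y' <= N)%N := leq_trans (le_truncn y'4) XN.
have y'L : y' <= x + (2 * X) `^ (1 / 2 + p).
  by rewrite lerD2l; apply: ge0_ler_powR; rewrite ?nnegrE; lra.
apply: le_trans (sum_count_square_large_le _ B N _ _ _ _ y'L y'4).
move: dev; rewrite -/y' (squarefull_count_split _ _ _ _ _ BN xy' y'N).
have := sum_count_square_diff _ B _ _ _ (ltW x0) xy' y'N.
have := sqrt_increment _ _ _ s0 (ltW h0).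
have -> : Num.sqrt (s ^+ 2 + s * h) = Num.sqrt y' by rewrite /y' s2 H.
rewrite -/s.
set M := \sum_(1 <= b < _ | _) _; set T := \sum_(B.+1 <= b < _ | _) _.
set D := Num.sqrt y'; set u := h ^+ 2 / s => Du MB dev.
have uh : 12 * u <= eta * h.
  rewrite /u mulrA ler_pdivrMr// expr2; nra.
have S3 : sqf32_sum R B <= 3 :=
  le_trans (sqf32_sum_le_inv32_sum _ _) (inv32_sum_le3 _ _).
have Sp : 0 <= sqf32_sum R B by apply: sumr_ge0 => b _; exact: inv32_ge0.
have B4 : 4 * B%:R <= eta * h.
  by rewrite ler_pdivrMr// in XB; apply: le_trans XB _; rewrite mulrC ler_pM2l.
have T0 : 0 <= T.
  apply: sumr_ge0 => b _; rewrite subr_ge0 ler_nat /count_square.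
  apply: leq_sum => a _; case: (leP _ x) => // ax.
  by rewrite (le_trans ax xy').
have main : `|M + T - S / 2 * h| <= T + 3 / 4 * eta * h.
  have -> : M + T - S / 2 * h = T + ((M - (D - s) * sqf32_sum R B)
     + (D - s - h / 2) * sqf32_sum R B - (S - sqf32_sum R B) * (h / 2)) by field.
  apply: le_trans (ler_normD _ _) _; rewrite (ger0_norm T0) lerD2l.
  apply: le_trans (ler_normB _ _) _.
  have : `|(D - s - h / 2) * sqf32_sum R B| <= u * 3.
    by rewrite normrM (ger0_norm Sp); apply: ler_pM.
  have : `|(S - sqf32_sum R B) * (h / 2)| <= eta / 2 * (h / 2).
    rewrite normrM !ger0_norm ?subr_ge0 ?divr_ge0 ?(ltW h0)//.
    by apply: ler_wpM2r => //; rewrite divr_ge0 ?ltW.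
  have := ler_normD (M - (D - s) * sqf32_sum R B) ((D - s - h / 2) * sqf32_sum R B).
  lra.
have : eta / 4 * X `^ p <= eta / 4 * h by rewrite ler_pM2l// divr_gt0.
lra.
Qed.

(** There are at most [2 * sqrt X * tau] points and [L <= 2 * X ^ (1 / 2 + p)];
against the threshold [eta / 4 * X ^ p] this gives [16 * tau * X / eta]. *)
Lemma large_cube_measure (R : realType) (p eta tau : R) (B N : nat) (X : R) :
  0 < eta -> 1 <= X -> 0 < p < 1 / 2 -> (B <= N)%N ->
  inv32_sum R N - inv32_sum R B <= tau ->
  (lebesgue_measure [set x : R | (eta / 4 * X `^ p <=
     \sum_(r <- large_cube_points R B N (4 * X))
       (\1_(`[r - (2 * X) `^ (1 / 2 + p), r[%classic : set R) x : R))%R]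
   <= (16 * tau / eta * X)%:E)%E.
Proof.
move=> eta0 X1 /andP[p0 p12] BN tailB.
have X0 : 0 < X by apply: lt_le_trans X1.
have Xp : 0 < X `^ p by exact: powR_gt0.
apply: le_trans (markov_intervals _ _ _ _ _ _) _.
- exact: powR_ge0.
- by rewrite mulr_gt0// divr_gt0.
rewrite lee_fin.
pose s := Num.sqrt X.
have s0 : 0 < s by rewrite sqrtr_gt0.
have XE : X = s ^+ 2 by rewrite sqr_sqrtr// ltW.
have L2 : (2 * X) `^ (1 / 2 + p) <= 2 * (s * X `^ p).
  rewrite powRM ?(ltW X0)//; apply: ler_pM; rewrite ?powR_ge0//.
    by apply: ler1_powR; lra.
  rewrite powRD; last by apply/implyP => _; rewrite gt_eqF.
  by rewrite mul1r powR12_sqrt// ltW.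
have sz : (size (large_cube_points R B N (4 * X)))%:R <= 2 * s * tau.
  apply: le_trans (size_large_cube_points _ _ _ _ BN _) _; first lra.
  rewrite sqrtrM// (_ : 4 = 2 ^+ 2 :> R); last by rewrite -natrX.
  by rewrite sqrtr_sqr ger0_norm// ler_wpM2l// mulr_ge0// ltW.
rewrite ler_pdivrMr ?mulr_gt0 ?divr_gt0//.
apply: le_trans (ler_pM _ _ sz L2) _; rewrite ?powR_ge0//.
set w := X `^ p; rewrite [in leRHS]XE le_eqVlt; apply/orP; left; apply/eqP; field.
by rewrite gt_eqF.
Qed.

Theorem corollary2 (R : realType) (theta : R) (htheta : 0 < theta < 1 / 2)
    (eta : R) (heta : 0 < eta) :
  fine (lebesgue_measure
     [set x : R | X <= x <= 2 * X /\
        `| (squarefull_count (x + x `^ (1 / 2 + theta)))%:R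
           - (squarefull_count x)%:R
           - zeta (3 / 2) / (2 * zeta 3) * x `^ theta |
        > eta * x `^ theta]) / X @[X --> +oo] --> (0 : R).
Proof.
have -> : zeta (3 / 2 : R) / (2 * zeta 3) = limn (sqf32_sum R) / 2.
  by rewrite limn_sqf32_sum invfM mulrCA mulrC.
apply/cvgrPdist_le => e e0.
have tau0 : 0 < e * eta / 16 by rewrite divr_gt0// mulr_gt0.
have eta2 : 0 < eta / 2 by rewrite divr_gt0.
have [B [tailB sfB]] : exists B,
    (forall N, inv32_sum R N - inv32_sum R B <= e * eta / 16) /\
    `|limn (sqf32_sum R) - sqf32_sum R B| <= eta / 2.
  have /cvgrPdist_le /(_ _ eta2) cS := @is_cvg_sqf32_sum R.
  by have [B] := filter_ex (filterI (inv32_sum_tail _ _ tau0) cS) => -[]; exists B.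
have sfS : sqf32_sum R B <= limn (sqf32_sum R).
  apply: nondecreasing_cvgn_le; last exact: is_cvg_sqf32_sum.
  by apply: nondecreasing_sum_nat; exact: inv32_ge0.
have theta_gt0 : 0 < theta by case/andP: htheta.
have theta'_gt0 : 0 < 1 / 2 - theta by rewrite subr_gt0; case/andP: htheta.
near=> X.
have X1 : 1 <= X by near: X; exact: nbhs_pinfty_ge.
have X0 : 0 < X by apply: lt_le_trans X1.
pose N := maxn B (Num.truncn (4 * X)).
have BN : (B <= N)%N by exact: leq_maxl.
set E := [set x | _].
have mE : (lebesgue_measure E <= (e * X)%:E)%E.
  have -> : e * X = 16 * (e * eta / 16) / eta * X by field; rewrite gt_eqF.
  apply: le_trans (large_cube_measure _ _ _ _ _ _ _ heta X1 htheta BN (tailB N)).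
  apply: le_lebesgue_measure; apply: deviation_subset => //.
  - exact: le_trans (ler_norm _) sfB.
  - by near: X; exact: near_powR_ge.
  - by near: X; exact: near_powR_ge.
  - exact: leq_maxr.
have mE0 : (0 <= lebesgue_measure E)%E by exact: measure_ge0.
have : 0 <= fine (lebesgue_measure E) <= e * X.
  rewrite fine_ge0//= -lee_fin fineK// ge0_fin_numE//.
  exact: le_lt_trans mE (ltry _).
move=> /andP[f0 fe].
rewrite sub0r normrN ger0_norm ?divr_ge0 ?(ltW X0)//.
by rewrite ler_pdivrMr.
Unshelve. all: by end_near. Qed.
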